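(* Let $H$ be a nonzero complex Hilbert space and let $V\subseteq\{\xi\in H:\|\xi\|=1\}$ be a norm-closed set satisfying V1: $\lambda\cdot V\subseteq V$ for every $\lambda\in\mathbb C$ with $|\lambda|=1$; and V2: for $\xi\in H$, if $\langle\xi,\eta\rangle=0$ for all $\eta\in V$ then $\xi=0$. Then the extended real-valued function $\|\cdot\|^V:H\to[0,+\infty]$ has the following properties: (i) $\|\xi+\eta\|^V\le\|\xi\|^V+\|\eta\|^V$ for all $\xi,\eta\in H$. (ii) $\|\lambda\cdot\xi\|^V=|\lambda|\cdot\|\xi\|^V$ for all $0\ne\lambda\in\mathbb C$ and $\xi\in H$. (iii) It is weakly lower semicontinuous. (iv) The closed convex hull of $V$ is $\{\xi\in H:\|\xi\|^V\le1\}$. This function is uniquely determined: if $u:H\to[0,+\infty]$ is any function that satisfies (ii) and (iv), i.e. $u(\lambda\xi)=|\lambda|u(\xi)$ for all $0\neq\lambda\in\mathbb C$, $\xi\in H$, and the closed convex hull of $V$ equals $\{\xi\in H:u(\xi)\le1\}$, then $u(\xi)=\|\xi\|^V$ for all $\xi\in H$.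
   Context: For $\xi\in H$ define $\|\xi\|_V=\sup_{\eta\in V}|\langle\xi,\eta\rangle|$ and $\|\xi\|^V=\sup\{|\langle\xi,\eta\rangle|:\eta\in H,\ \|\eta\|_V\le1\}\in[0,+\infty]$. A function $u:H\to[0,+\infty]$ is weakly lower semicontinuous if for every $r\in[0,+\infty)$ the set $\{\xi\in H:u(\xi)\le r\}$ is closed in the weak topology of $H$. The closed convex hull of a set is the norm closure (equivalently, the weak closure) of its convex hull. *)

(* Defs.v *)
From HB Require Import structures.
From mathcomp Require Import all_boot all_order all_algebra.
From mathcomp Require Import complex.
From mathcomp Require Import all_classical all_reals all_analysis.

Set Implicit Arguments.
Unset Strict Implicit.
Unset Printing Implicit Defensive.

Import Order.TTheory GRing.Theory Num.Theory.
Import numFieldNormedType.Exports.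

Local Open Scope classical_set_scope.
Local Open Scope ring_scope.
Local Open Scope complex_scope.

(* On R[i] the norm `|z| of MathComp has type R[i]; its value is the real
   number [cmod z], embedded in R[i]. *)
Notation cmod := ComplexField.Normc.normc.

(* Complex inner products, linear in the first argument and conjugate-linear in
   the second, that are Hermitian and positive definite.  A complex Hilbert
   space is a complete normed module over R[i] whose norm comes from one. *)
Notation inner_product H := {dot H for @Num.conj _}.

Definition induces_norm (R : realType) (H : normedModType R[i])
    (dot : H -> H -> R[i]) : Prop :=
  forall x : H, `|x| ^+ 2 = dot x x.

Section polar_norms.
Context (R : realType) (H : normedModType R[i]) (dot : H -> H -> R[i]).

(* [norm_sub V x] is the quantity written with V as a subscript, [norm_sup V x]
   the one with V as a superscript.  Suprema are taken in \bar R, where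
   [ereal_sup set0 = -oo]; this value does not occur when V separates the points
   of a nonzero H, since V is then nonempty and [norm_sub V 0 = 0]. *)
Definition norm_sub (V : set H) (x : H) : \bar R :=
  ereal_sup [set (cmod (dot x y))%:E | y in V].

Definition norm_sup (V : set H) (x : H) : \bar R :=
  ereal_sup [set (cmod (dot x y))%:E | y in [set y | (norm_sub V y <= 1)%E]].

End polar_norms.

(* The coarsest topology for which every norm-continuous linear functional is
   continuous. *)
Definition weak_topology (K : numFieldType) (E : normedModType K) : Type :=
  sup_topology (fun f : {f : {linear E -> K^o} | continuous (f : E -> K^o)} =>
    Topological.class (initial_topology (sval f : E -> K^o))).

HB.instance Definition _ (K : numFieldType) (E : normedModType K) :=
  Topological.on (weak_topology E).

Definition weakly_lower_semicontinuous (R : realType) (K : numFieldType)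
    (E : normedModType K) (u : E -> \bar R) : Prop :=
  forall r : R, 0 <= r ->
    closed ([set x | (u x <= r%:E)%E] : set (weak_topology E)).

(* [convex_set] over R[i] uses coefficients t : R[i] with 0 <= t <= 1; such t
   are real, so this is the usual notion of convexity. *)
Definition convex_hull (K : numDomainType) (E : lmodType K) (A : set E)
    : set E :=
  smallest (@convex_set K E) A.

Definition closed_convex_hull (K : numFieldType) (E : normedModType K)
    (A : set E) : set E :=
  closure (convex_hull A).

Definition abs_homogeneous (R : realType) (H : lmodType R[i])
    (u : H -> \bar R) : Prop :=
  forall (l : R[i]) (x : H), l != 0 -> u (l *: x) = ((cmod l)%:E * u x)%E.

(* Main.v *)
Require Import Defs.
From HB Require Import structures.
From mathcomp Require Import all_boot all_order all_algebra.
From mathcomp Require Import complex ring lra.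
From mathcomp Require Import all_classical all_reals all_analysis.
Import Order.TTheory GRing.Theory Num.Theory.
Import numFieldNormedType.Exports.
Local Open Scope classical_set_scope.
Local Open Scope ring_scope.
Local Open Scope complex_scope.

(* The inclusion of the closed convex hull in the unit ball of the polar norm
   holds because that ball is an intersection of weakly closed convex sets
   [set x | `|dot x y| <= 1]; the reverse inclusion is the bipolar theorem.  A
   point x outside the closure of the (bounded) convex hull is separated from
   it by the functional of w = x - p, where p is a nearly nearest point of the
   hull: the slack in the minimality of p costs less than the squared distance
   d, so no exact projection is needed.  By V1 the bound on Re (dot v w) is one
   on its modulus, by V2 that bound is positive, and rescaling w by it gives a
   point of the polar that detects x.  Uniqueness: by homogeneity the unit ball
   determines all sublevel sets [set x | u x <= r] with r > 0. *)

(** * Convexity, balls and the weak topology over [R[i]] *)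

Section normed_modules.
Set Implicit Arguments.
Unset Strict Implicit.
Context (R : realType).

Lemma normC_cmod (z : R[i]) : `|z| = (cmod z)%:C.
Proof. by []. Qed.

Lemma cmod_ge0 (z : R[i]) : 0 <= cmod z.
Proof. by rewrite -lecR -normC_cmod normr_ge0. Qed.

Lemma Re_le_cmod (z : R[i]) : complex.Re z <= cmod z.
Proof.
by rewrite (le_trans (ler_norm _))// -lecR; exact: normc_ge_Re.
Qed.

Lemma norm_le_closed (E : normedModType R[i]) (r : R) :
  closed [set z : E | `|z| <= r%:C].
Proof.
move=> z clz /=; rewrite real_leNgt ?complex_real ?normr_real//.
apply/negP => rz.
have e0 : 0 < `|z| - r%:C by rewrite subr_gt0.
have [w []/= wr] := clz _ (nbhsx_ballx z _ e0).
rewrite -ball_normE/= => zw.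
have := ler_normD (z - w) w; rewrite subrK.
move=> /(le_lt_trans)/(_ (ltr_leD zw wr)).
by rewrite subrK ltxx.
Qed.

Lemma sub_convex_hull (E : lmodType R[i]) (A : set E) : A `<=` convex_hull A.
Proof. exact: sub_gen_smallest. Qed.

Lemma convex_hull_convex (E : lmodType R[i]) (A : set E) :
  convex_set (convex_hull A).
Proof.
move=> x y t /set_mem Ax /set_mem Ay; apply/mem_set => C [cC AC].
by apply/set_mem; apply: (cC); apply/mem_set; [exact: Ax | exact: Ay].
Qed.

(** A general [f] covers both the functionals [dotl dot y] and the identity, which yields convexity
    of norm balls. *)
Lemma linear_preimage_ball_convex (E : lmodType R[i]) (F : normedModType R[i])
    (f : {linear E -> F}) (r : R) :
  convex_set [set x : E | `|f x| <= r%:C].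
Proof.
move=> x y t /set_mem/= xr /set_mem/= yr; apply/mem_set => /=.
have t1 : 0 <= 1 - t%:num by rewrite subr_ge0.
rewrite [f _](_ : _ = t%:num *: f x + (1 - t%:num) *: f y); last first.
  by rewrite -!linearZ -linearD.
rewrite (le_trans (ler_normD _ _))// !normrZ !ger0_norm//.
rewrite (@le_trans _ _ (t%:num * r%:C + (1 - t%:num) * r%:C))//.
  by rewrite lerD// ler_wpM2l.
by rewrite -mulrDl addrC subrK mul1r.
Qed.

Lemma convex_set_segment (E : lmodType R[i]) (A : set E) (x y : E) (t : R) :
  convex_set A -> A x -> A y -> 0 <= t -> t <= 1 ->
  A (t%:C *: x + (1 - t%:C) *: y).
Proof.
move=> cA Ax Ay t0 t1.
have t0' : 0 <= t%:C by rewrite lecR.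
have t1' : t%:C <= 1 by rewrite lecR.
by have /set_mem := cA x y (Itv01 t0' t1') (mem_set Ax) (mem_set Ay).
Qed.

(** The weak topology is a supremum of initial topologies, one of which is that of [f], so it
    refines the latter. *)
Lemma weak_continuous (H : normedModType R[i]) (f : {linear H -> R[i]^o}) :
  continuous f ->
  continuous (f : weak_topology H -> R[i]^o).
Proof.
move=> cf x.
pose i : {f : {linear H -> R[i]^o} | continuous (f : H -> R[i]^o)} :=
  exist _ f cf.
have /cvg_sup/(_ i) h :
  nbhs (x : weak_topology H) --> (x : weak_topology H) by [].
apply: cvg_trans (@initial_continuous _ _ (f : H -> R[i]^o) x).
exact: cvg_app.
Qed.

End normed_modules.

(** * Cauchy-Schwarz and separation from bounded convex sets *)

Section inner_product_theory.
Set Implicit Arguments.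
Unset Strict Implicit.
Context (R : realType) (H : normedModType R[i]) (dot : inner_product H).
Implicit Types (x y z : H).

Lemma dotC x y : dot x y = (dot y x)^*.
Proof. by rewrite hermC expr0 mul1r. Qed.

Lemma cmod_dotC x y : cmod (dot x y) = cmod (dot y x).
Proof. by apply/complexI; rewrite -!normC_cmod dotC norm_conjC. Qed.

Definition dotl y : H -> R[i]^o := dot ^~ y.

Lemma dotl_is_linear y : linear (dotl y).
Proof. by move=> a u v; rewrite /dotl linearPl. Qed.

HB.instance Definition _ y :=
  GRing.isLinear.Build R[i] H R[i]^o _ (dotl y) (dotl_is_linear y).

Lemma dot_Cauchy_Schwarz x y : `|dot x y| ^+ 2 <= dot x x * dot y y.
Proof.
have [->|y0] := eqVneq y 0; first by rewrite !linear0r normr0 expr0n.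
have q0 : 0 < dot y y by rewrite dnorm_gt0.
(* The squared norm of this vector is [dot y y] times the difference of the two sides of the
   claim. *)
have := dnorm_ge0 dot (dot y y *: x - dot x y *: y).
rewrite dnormB !dnormZ linearZl_LR linearZr_LR/= -normCKC.
rewrite (geC0_conj (mulr_ge0 (ltW q0) (exprn_ge0 2 (normr_ge0 _)))).
rewrite (ger0_norm (ltW q0)) => h.
rewrite -subr_ge0 -(pmulr_rge0 _ q0); move: h; congr (0 <= _).
by ring.
Qed.

Hypothesis dot_norm : induces_norm dot.

Lemma dotl_continuous y : continuous (dotl y).
Proof.
apply: bounded_linear_continuous; apply/linear_boundedP.
near=> r => x.
have r0 : `|y| <= r by near: r; exact: nbhs_pinfty_ge.
apply: (@le_trans _ _ (`|y| * `|x|)); last by rewrite ler_wpM2r.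
rewrite -(@ler_pXn2r _ 2%N) ?nnegrE ?mulr_ge0//.
by rewrite exprMn !dot_norm mulrC; exact: dot_Cauchy_Schwarz.
Unshelve. all: by end_near. Qed.

(** This moves inequalities from the partially ordered [R[i]] to [R], where [lra] and [nra]
    apply. *)
Lemma dnorm_Re x : dot x x = (complex.Re (dot x x))%:C.
Proof. by rewrite RRe_real// ger0_real// dnorm_ge0. Qed.

Lemma Re_dnormBZ (x y : H) (t : R) :
  complex.Re (dot (x - t%:C *: y) (x - t%:C *: y)) =
  complex.Re (dot x x) - 2 * t * complex.Re (dot x y) +
  t ^+ 2 * complex.Re (dot y y).
Proof.
rewrite dnormB dnormZ linearZr_LR/= (dnorm_Re x) (dnorm_Re y).
rewrite normC_cmod -rmorphXn -rmorphM.
case: (dot x y) => a b /=.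
rewrite expr0n addr0 sqrtr_sqr real_normK ?num_real//.
ring.
Qed.

Lemma notin_closure_dnorm (A : set H) x : ~ closure A x ->
  exists2 e : R, 0 < e & forall z, A z -> e <= complex.Re (dot (x - z) (x - z)).
Proof.
move=> nclx.
have [B [Bx BA]] : exists B, nbhs x B /\ forall z, A z -> ~ B z.
  apply: contrapT => h; apply: nclx => B Bx; apply: contrapT => AB0.
  by apply: h; exists B; split => // z Az Bz; apply: AB0; exists z.
have /nbhs_ballP[e /= e0 eB] := Bx.
have eR : e = (complex.Re e)%:C by rewrite RRe_real// gtr0_real.
(* The witness is the squared radius of a ball around [x] that misses [A]. *)
exists (complex.Re e ^+ 2) => [|z Az].
  by rewrite exprn_gt0// -ltcR -eR.
rewrite -lecR -dnorm_Re -dot_norm rmorphXn/= -eR.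
rewrite ler_pXn2r ?nnegrE ?(ltW e0)//.
rewrite real_leNgt ?normr_real ?(gtr0_real e0)//; apply/negP => xz.
by apply: (BA _ Az); apply: eB; rewrite -ball_normE.
Qed.

Lemma convex_separation (A : set H) (M : R) x :
  A !=set0 -> convex_set A -> (forall z, A z -> `|z| <= M%:C) ->
  ~ closure A x ->
  exists w (s : R), (forall z, A z -> complex.Re (dot z w) <= s) /\
    s < complex.Re (dot x w).
Proof.
move=> [a Aa] cA bA /notin_closure_dnorm[e e0 eA].
pose D := [set complex.Re (dot (x - z) (x - z)) | z in A].
have Dlb : has_lbound D by exists e => _ [z Az <-]; exact: eA.
have Dinf : has_inf D by split => //; eexists; exists a.
pose d := inf D.
have d0 : 0 < d.
  apply: (lt_le_trans e0); apply: lb_le_inf; first by case: Dinf.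
  by move=> _ [z Az <-]; exact: eA.
(* [K] bounds [|z - p|^2] for [z] and [p] in [A], both of norm at most [M]. *)
pose K := (M + M) ^+ 2.
have K0 : 0 <= K by exact: sqr_ge0.
(* Moving from p a fraction t towards z gives d <= `|w - t (z - p)|^2; as
   `|w|^2 < d + t^2, expanding yields 2 Re (dot (z - p) w) <= t (1 + K) <= d. *)
pose t := d / (d + 1 + K).
have q0 : 0 < d + 1 + K by lra.
have t0 : 0 < t by rewrite divr_gt0.
have t1 : t <= 1 by rewrite ler_pdivrMr// mul1r; lra.
have tK : t * (1 + K) <= d.
  rewrite /t mulrAC ler_pdivrMr// ler_wpM2l ?(ltW d0)//; lra.
have [_ [p Ap <-] dp] := inf_adherent (exprn_gt0 2 t0) Dinf.
pose w := x - p.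
have dA z : A z -> d <= complex.Re (dot (x - z) (x - z)).
  by move=> Az; apply: ge_inf => //; exists z.
(* The threshold fits both sides: [2 Re (dot (z - p) w) <= d] on [A], while
   [Re (dot (x - p) w) = |w|^2 >= d > d / 2]. *)
exists w, (complex.Re (dot p w) + d / 2); split => [z Az|].
  have zpK : complex.Re (dot (z - p) (z - p)) <= K.
    rewrite -lecR -dnorm_Re -dot_norm rmorphXn/= ler_pXn2r ?nnegrE//.
    - by rewrite rmorphD (le_trans (ler_normB _ _))// lerD// bA.
    - by rewrite rmorphD (le_trans _ (lerD (bA _ Az) (bA _ Ap)))// addr_ge0.
  have := dA _ (convex_set_segment cA Az Ap (ltW t0) t1).
  have -> : x - (t%:C *: z + (1 - t%:C) *: p) = w - t%:C *: (z - p).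
    by rewrite /w scalerBl scale1r scalerBr !opprD !opprK !addrA (addrAC x).
  rewrite Re_dnormBZ.
  have -> : complex.Re (dot w (z - p)) =
      complex.Re (dot z w) - complex.Re (dot p w).
    by rewrite (dotC w) linearBl/=; case: (dot z w) (dot p w) => [? ?] [? ?].
  rewrite -/w in dp.
  set r := complex.Re (dot z w); set r' := complex.Re (dot p w).
  set q := complex.Re (dot w w) in dp *.
  set k := complex.Re (dot (z - p) (z - p)) in zpK *.
  move=> h.
  have tk : t ^+ 2 * k <= t ^+ 2 * K by rewrite ler_wpM2l// sqr_ge0.
  have : t * (2 * (r - r')) <= t * (t * (1 + K)) by rewrite -/d in dp; nra.
  rewrite ler_pM2l// => ?; lra.
have -> : complex.Re (dot x w) = complex.Re (dot p w) + complex.Re (dot w w).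
  have -> : dot x w = dot p w + dot w w by rewrite -linearDl /w subrKC.
  by case: (dot p w) (dot w w) => [? ?] [? ?].
by rewrite ltrD2l; have := dA _ Ap; rewrite -/w; lra.
Qed.

End inner_product_theory.

(** * The polar norm and the bipolar theorem *)

Section norm_sup_theory.
Set Implicit Arguments.
Unset Strict Implicit.
Context (R : realType) (H : normedModType R[i]) (dot : inner_product H).
Context (V : set H).
Implicit Types (x y z : H).

Definition polar : set H := [set y | forall v, V v -> cmod (dot y v) <= 1].

Lemma norm_sub_le1 y : (norm_sub dot V y <= 1)%E <-> polar y.
Proof.
split=> [h v Vv|h].
  by rewrite -lee_fin (le_trans _ h)//; apply: ereal_sup_ubound; exists v.
by apply: ge_ereal_sup => _ [v Vv <-]; rewrite lee_fin; exact: h.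
Qed.

Lemma norm_sup_ub x y : polar y -> ((cmod (dot x y))%:E <= norm_sup dot V x)%E.
Proof.
by move=> Py; apply: ereal_sup_ubound; exists y => //; exact/norm_sub_le1.
Qed.

Lemma norm_sup_le x (m : \bar R) :
  (norm_sup dot V x <= m)%E <->
  forall y, polar y -> ((cmod (dot x y))%:E <= m)%E.
Proof.
split=> [h y Py|h]; first exact: le_trans (norm_sup_ub _ Py) h.
by apply: ge_ereal_sup => _ [y /norm_sub_le1 Py <-]; exact: h.
Qed.

Lemma norm_sup_ge0 x : (0 <= norm_sup dot V x)%E.
Proof.
have P0 : polar 0.
  by move=> v Vv; rewrite linear0l ComplexField.Normc.normc0.
by have := norm_sup_ub x P0; rewrite linear0r ComplexField.Normc.normc0.
Qed.

Lemma norm_supD x y :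
  (norm_sup dot V (x + y)%R <= norm_sup dot V x + norm_sup dot V y)%E.
Proof.
apply/norm_sup_le => w Pw.
apply: le_trans (leeD (norm_sup_ub x Pw) (norm_sup_ub y Pw)).
by rewrite -EFinD lee_fin linearDl -lecR rmorphD/= -!normC_cmod ler_normD.
Qed.

Lemma norm_sup_homo : abs_homogeneous (norm_sup dot V).
Proof.
(* This inequality holds for all [l]; applied to [l^-1] and [l *: x], it gives the reverse one. *)
have le l x : (norm_sup dot V (l *: x) <= (cmod l)%:E * norm_sup dot V x)%E.
  apply/norm_sup_le => w Pw; rewrite linearZl_LR/= ComplexField.Normc.normcM.
  rewrite EFinM.
  by apply: lee_wpmul2l; [rewrite lee_fin cmod_ge0 | exact: norm_sup_ub].
move=> l x l0; apply/eqP; rewrite eq_le le/=.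
have c0 : 0 < cmod l by rewrite -ltcR -normC_cmod normr_gt0.
rewrite -lee_pdivlMl//.
have := le l^-1 (l *: x); rewrite scalerA mulVf// scale1r.
by rewrite ComplexField.Normc.normcV.
Qed.

(** Pulling closed balls back along continuous functionals yields weak closedness, norm closedness
    and convexity alike. *)
Lemma norm_sup_sublevelE (r : R) :
  [set x | (norm_sup dot V x <= r%:E)%E] =
  \bigcap_(y in polar) dotl dot y @^-1` [set z : R[i]^o | `|z| <= r%:C].
Proof.
apply/seteqP; split=> x /=.
  by move=> /norm_sup_le h y /h; rewrite lee_fin -lecR.
by move=> h; apply/norm_sup_le => y /h; rewrite lee_fin /= -lecR.
Qed.

Hypothesis dot_norm : induces_norm dot.

Lemma norm_sup_weakly_lsc : weakly_lower_semicontinuous (norm_sup dot V).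
Proof.
move=> r _; rewrite norm_sup_sublevelE; apply: closed_bigI => y _.
apply: (@preimage_closed (weak_topology H)); last exact: norm_le_closed.
by move=> x _; apply: weak_continuous; exact: dotl_continuous.
Qed.

Lemma norm_sup_le1_closed : closed [set x | (norm_sup dot V x <= 1)%E].
Proof.
rewrite norm_sup_sublevelE; apply: closed_bigI => y _.
apply: preimage_closed; last exact: norm_le_closed.
by move=> x _; exact: dotl_continuous.
Qed.

Lemma norm_sup_le1_convex :
  convex_set [set x | (norm_sup dot V x <= 1)%E].
Proof.
rewrite norm_sup_sublevelE => x y t /set_mem Hx /set_mem Hy.
apply/mem_set => w Pw; apply/set_mem.
apply: (@linear_preimage_ball_convex _ _ _ (dotl dot w) 1); apply/mem_set.
  exact: Hx.
exact: Hy.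
Qed.

Hypothesis V_sphere : V `<=` [set x | `|x| = 1].
Hypothesis V1 : forall l : R[i], `|l| = 1 -> [set l *: x | x in V] `<=` V.

Lemma cmod_dot_le (w : H) (s : R) :
  (forall v, V v -> complex.Re (dot v w) <= s) ->
  forall v, V v -> cmod (dot v w) <= s.
Proof.
move=> h v Vv; have [d0|d0] := eqVneq (dot v w) 0.
  by have := h _ Vv; rewrite d0 ComplexField.Normc.normc0.
(* Rotating [v] by the conjugate phase makes [dot (l *: v) w] equal to its own modulus; V1 keeps the
   rotated vector in [V]. *)
pose l := (dot v w)^* / `|dot v w|.
have l1 : `|l| = 1.
  by rewrite normrM normfV normr_id norm_conjC divff// normr_eq0.
have Vlv : V (l *: v) by apply: (V1 l1); exists v.
have := h _ Vlv; rewrite linearZl_LR/=.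
have -> : l * dot v w = (cmod (dot v w))%:C.
  by rewrite -normC_cmod /l mulrAC -normCKC expr2 mulfK// normr_eq0.
by [].
Qed.

Hypothesis H_neq0 : exists x : H, x != 0.
Hypothesis V2 : forall x : H, (forall y, V y -> dot x y = 0) -> x = 0.

Lemma closed_convex_hullE :
  closed_convex_hull V = [set x | (norm_sup dot V x <= 1)%E].
Proof.
apply/seteqP; split.
  rewrite [X in _ `<=` X](closure_id _).1; last exact: norm_sup_le1_closed.
  apply: closureS; apply: smallest_sub; first exact: norm_sup_le1_convex.
  move=> v Vv; apply/norm_sup_le => y Py; rewrite lee_fin cmod_dotC; exact: Py.
move=> x /= x1; apply: contrapT => nx.
(* With [V] empty, V2 would make every vector zero. *)
have [v0 Vv0] : V !=set0.
  apply: contrapT => V0; have [z /eqP] := H_neq0; apply.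
  by apply: V2 => y Vy; case: V0; exists y.
have hull1 z : convex_hull V z -> `|z| <= 1%:C.
  apply: (smallest_sub (@linear_preimage_ball_convex _ H H idfun 1)) => v Vv /=.
  by rewrite (V_sphere Vv).
have hull0 : convex_hull V !=set0 by exists v0; exact: sub_convex_hull.
have [w [s [ws sx]]] :=
  convex_separation dot_norm hull0 (@convex_hull_convex _ _ V) hull1 nx.
have Vs := cmod_dot_le (fun v Vv => ws v (sub_convex_hull Vv)).
(* If [s] were 0, [w] would be orthogonal to [V], hence zero by V2, contradicting
   [s < Re (dot x w)]. *)
have s0 : 0 < s.
  rewrite lt_neqAle (le_trans (cmod_ge0 _) (Vs _ Vv0)) andbT.
  apply/eqP => s0; move: sx.
  rewrite -s0 (V2 (x := w)) ?linear0r ?ltxx// => v Vv.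
  apply: ComplexField.Normc.eq0_normc; rewrite cmod_dotC.
  by apply/eqP; rewrite eq_le cmod_ge0 andbT s0; exact: Vs.
have csV : cmod (s^-1)%:C = s^-1.
  by apply: complexI; rewrite -normC_cmod ger0_norm ?lecR ?invr_ge0 ?ltW.
(* Pairing [x] with this polar point gives modulus at least [Re (dot x w) / s > 1], contradicting
   [x1]. *)
have Pw : polar ((s^-1)%:C *: w).
  move=> v Vv; rewrite linearZl_LR/= ComplexField.Normc.normcM csV.
  by rewrite ler_pdivrMl// mulr1 cmod_dotC; exact: Vs.
have := (norm_sup_le _ _).1 x1 _ Pw.
rewrite lee_fin cmod_dotC linearZl_LR/= ComplexField.Normc.normcM csV.
rewrite ler_pdivrMl// mulr1 cmod_dotC => /(le_trans (Re_le_cmod _)).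
by rewrite leNgt sx.
Qed.

End norm_sup_theory.

(** * Uniqueness and assembly of the theorem *)

Lemma abs_homogeneous_unique (R : realType) (H : lmodType R[i])
    (u v : H -> \bar R) :
  (forall x, (0 <= u x)%E) -> (forall x, (0 <= v x)%E) ->
  abs_homogeneous u -> abs_homogeneous v ->
  [set x | (u x <= 1)%E] = [set x | (v x <= 1)%E] -> u =1 v.
Proof.
move=> u0 v0 hu hv uv.
have le_of (f : H -> \bar R) (r : R) x : abs_homogeneous f -> 0 < r ->
    (f x <= r%:E)%E = (f ((r^-1)%:C *: x) <= 1)%E.
  move=> hf r0; have rV0 : 0 < r^-1 by rewrite invr_gt0.
  have cr : cmod (r^-1)%:C = r^-1.
    by apply: complexI; rewrite -normC_cmod ger0_norm ?lecR ?ltW.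
  rewrite hf; last by rewrite -normr_gt0 normC_cmod cr ltcR.
  by rewrite cr lee_pdivrMl// mule1.
have uvr r x : 0 < r -> (u x <= r%:E)%E = (v x <= r%:E)%E.
  move=> r0; rewrite (le_of u _ _ hu r0) (le_of v _ _ hv r0).
  have /seteqP[h1 h2] := uv.
  by apply/idP/idP; [exact: h1 | exact: h2].
have le_uv (f g : H -> \bar R) x : (forall x, (0 <= g x)%E) ->
    (forall r x, 0 < r -> (f x <= r%:E)%E = (g x <= r%:E)%E) -> (f x <= g x)%E.
  (* Scaling reaches only positive radii, so a finite value [r], possibly 0, is approached by
     [r + e]; nonnegativity rules out [-oo]. *)
  move=> g0 fg; case E : (g x) (g0 x) => [r| |]; rewrite ?leey ?leeNy_eq//.
  rewrite lee_fin => r0; apply/lee_addgt0Pr => e e0.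
  by rewrite -EFinD fg ?ltr_wpDl// E lee_fin lerDl ltW.
by move=> x; apply/eqP; rewrite eq_le !le_uv// => r y r0; rewrite uvr.
Qed.

Theorem proposition2p1 (R : realType) (H : completeNormedModType R[i])
    (dot : inner_product H) (dot_norm : induces_norm dot)
    (H_neq0 : exists x : H, x != 0)
    (V : set H) (V_sphere : V `<=` [set x | `|x| = 1]) (V_closed : closed V)
    (V1 : forall l : R[i], `|l| = 1 -> [set l *: x | x in V] `<=` V)
    (V2 : forall x : H, (forall y, V y -> dot x y = 0) -> x = 0) :
  [/\ forall x : H, (0 <= norm_sup dot V x)%E,
      forall x y : H,
        (norm_sup dot V (x + y)%R <= norm_sup dot V x + norm_sup dot V y)%E,
      abs_homogeneous (norm_sup dot V),
      weakly_lower_semicontinuous (norm_sup dot V) &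
      closed_convex_hull V = [set x | (norm_sup dot V x <= 1)%E]] /\
  (forall u : H -> \bar R,
      (forall x, (0 <= u x)%E) ->
      abs_homogeneous u ->
      closed_convex_hull V = [set x | (u x <= 1)%E] ->
      forall x, u x = norm_sup dot V x).
Proof.
have hullE := closed_convex_hullE dot_norm V_sphere V1 H_neq0 V2.
split; first split.
- exact: norm_sup_ge0.
- exact: norm_supD.
- exact: norm_sup_homo.
- exact: norm_sup_weakly_lsc.
- exact: hullE.
move=> u u0 hu uE; apply: abs_homogeneous_unique => //.
- exact: norm_sup_ge0.
- exact: norm_sup_homo.
- by rewrite -uE.
Qed.
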